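(* Let $\mu$ be a monotone measure on $(X,\mathcal{B})$ and let $\mathcal{S}$ be one of the classes $\mathcal{S}^{P+},\ \mathcal{S}^{P+}_\mu,\ \mathcal{S}^{C+},\ \mathcal{S}^{C+}_\mu$. Then $\int^{\uparrow}_{\mathcal{S}}$ satisfies the monotone increasing convergence theorem: if $\{f_n\}_{n\in\mathbb{N}}$ is an increasing sequence of nonnegative measurable functions on $X$ converging pointwise to $f$, then $$\lim_{n\to\infty}\int^{\uparrow}_{\mathcal{S}} f_n\,d\mu=\int^{\uparrow}_{\mathcal{S}} f\,d\mu .$$
   Context: $(X,\mathcal{B})$ is a measurable space ($\mathcal{B}$ a $\sigma$-algebra on $X$). Measurable functions (including the limit $f$) are real-valued. A monotone measure is a set function $\mu:\mathcal{B}\to[0,\infty)$ with $\mu(\emptyset)=0$ and $\mu(A)\le\mu(B)$ whenever $A\subset B$; throughout, every monotone measure is assumed to be continuous from above and below, i.e. $A_n\nearrow A$ or $A_n\searrow A$ implies $\mu(A_n)\to\mu(A)$. No additivity is assumed. A simple function is a finite or infinite sequence of pairs $\varphi=\{(a_k,A_k)\}_k$ with $a_k\in\mathbb{R}$, $A_k\in\mathcal{B}$; it is identified with the function $\varphi(x)=\sum_k a_k 1_{A_k}(x)$ ($1_A$ the indicator function of $A$), but its basic sum $\mu(\varphi)=\sum_k a_k\mu(A_k)$ depends on the sequence of pairs. A partition of $X$ is a family of pairwise disjoint sets in $\mathcal{B}$ (possibly empty) with union $X$; a covering of $X$ is a family of sets in $\mathcal{B}$ with union $X$. The classes are: - $\mathcal{S}^{P+}$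 (resp. $\mathcal{S}^{C+}$): all finite sequences $\{(a_k,A_k)\}_{k=1}^n$, $n\in\mathbb{N}$, with $a_k\ge 0$ and $\{A_k\}_k$ a partition (resp. covering) of $X$; - $\mathcal{S}^{P+}_\mu$ (resp. $\mathcal{S}^{C+}_\mu$): all infinite sequences $\{(a_k,A_k)\}_{k=1}^\infty$ with $a_k\ge 0$, $\sum_k a_k\mu(A_k)<\infty$ and $\{A_k\}_k$ a partition (resp. covering) of $X$. For a class $\mathcal{S}$ and a measurable function $f$, $L(\mathcal{S},f)=\{\varphi\in\mathcal{S}:\varphi(x)\le f(x)\ \forall x\in X\}$ and $\int^{\uparrow}_{\mathcal{S}} f\,d\mu=\sup\{\mu(\varphi):\varphi\in L(\mathcal{S},f)\}$, taken in the extended reals (the value $+\infty$ is allowed). *)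

(* Defs.v *)
From mathcomp Require Import all_boot all_order all_algebra.
From mathcomp Require Import all_classical all_reals all_analysis.

Set Implicit Arguments.
Unset Strict Implicit.
Unset Printing Implicit Defensive.

Import Order.TTheory GRing.Theory Num.Theory.
Import numFieldNormedType.Exports.

Local Open Scope classical_set_scope.
Local Open Scope ring_scope.

(* Only the values on measurable sets matter;
   elsewhere mu is an arbitrary function. *)
Record monotone_measure (R : realType) (d : measure_display)
    (X : measurableType d) (mu : set X -> R) : Prop := MonotoneMeasure {
  mm_ge0 : forall A, measurable A -> 0 <= mu A ;
  mm_set0 : mu set0 = 0 ;
  mm_mono : forall A B, measurable A -> measurable B -> A `<=` B ->
    mu A <= mu B ;
  mm_continuous_below : forall A : (set X)^nat,
    (forall n, measurable (A n)) -> nondecreasing_seq A ->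
    mu (A n) @[n --> \oo] --> mu (\bigcup_n A n) ;
  mm_continuous_above : forall A : (set X)^nat,
    (forall n, measurable (A n)) -> nonincreasing_seq A ->
    mu (A n) @[n --> \oo] --> mu (\bigcap_n A n) }.

Section SimpleFunctions.
Context {R : realType} {d : measure_display} {X : measurableType d}.

(* A simple function is its sequence of pairs (a_k, A_k), not the underlying
   function.  Measurability of the A_k is part of [is_partition] and
   [is_covering]. *)
Inductive simple_seq : Type :=
| FinSimple (n : nat) (s : 'I_n -> R * set X)
| InfSimple (s : nat -> R * set X).

(* The infinite sums below are taken in the extended reals; they are only used
   for nonnegative coefficients, for which they always make sense. *)
Definition simple_val (phi : simple_seq) (x : X) : \bar R :=
  match phi with
  | FinSimple n s => (\sum_(k < n) ((s k).1 * \1_((s k).2) x)%:E)%E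
  | InfSimple s => (\sum_(0 <= k <oo) ((s k).1 * \1_((s k).2) x)%:E)%E
  end.

Definition basic_sum (mu : set X -> R) (phi : simple_seq) : \bar R :=
  match phi with
  | FinSimple n s => (\sum_(k < n) ((s k).1 * mu (s k).2)%:E)%E
  | InfSimple s => (\sum_(0 <= k <oo) ((s k).1 * mu (s k).2)%:E)%E
  end.

Definition is_covering (I : Type) (A : I -> set X) : Prop :=
  (forall i, measurable (A i)) /\ \bigcup_i A i = setT.

Definition is_partition (I : Type) (A : I -> set X) : Prop :=
  [/\ forall i, measurable (A i), trivIset setT A & \bigcup_i A i = setT].

Definition SPplus : set simple_seq := [set phi |
  exists (n : nat) (s : 'I_n -> R * set X),
    [/\ phi = FinSimple s, forall k, 0 <= (s k).1 &
        is_partition (fun k => (s k).2)]].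

Definition SCplus : set simple_seq := [set phi |
  exists (n : nat) (s : 'I_n -> R * set X),
    [/\ phi = FinSimple s, forall k, 0 <= (s k).1 &
        is_covering (fun k => (s k).2)]].

Definition SPplus_mu (mu : set X -> R) : set simple_seq := [set phi |
  exists s : nat -> R * set X,
    [/\ phi = InfSimple s, forall k, 0 <= (s k).1,
        (basic_sum mu phi < +oo)%E & is_partition (fun k => (s k).2)]].

Definition SCplus_mu (mu : set X -> R) : set simple_seq := [set phi |
  exists s : nat -> R * set X,
    [/\ phi = InfSimple s, forall k, 0 <= (s k).1,
        (basic_sum mu phi < +oo)%E & is_covering (fun k => (s k).2)]].

Definition lower_class (S : set simple_seq) (f : X -> R) : set simple_seq :=
  [set phi | S phi /\ forall x, (simple_val phi x <= (f x)%:E)%E].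

Definition int_below (S : set simple_seq) (mu : set X -> R) (f : X -> R) :
    \bar R :=
  ereal_sup [set basic_sum mu phi | phi in lower_class S f].

End SimpleFunctions.

Arguments simple_seq R {d} X.

(* Main.v *)
Require Import Defs.
From mathcomp Require Import all_boot all_order all_algebra.
From mathcomp Require Import all_classical all_reals all_analysis.
From mathcomp Require Import measurable_realfun.

Import Order.TTheory GRing.Theory Num.Theory.
Import numFieldNormedType.Exports.

Local Open Scope classical_set_scope.
Local Open Scope ring_scope.

(** Let [phi = {(a_k, A_k)}] lie below [f].  Each partial sum of the basic sum
    of [phi] only involves finitely many pairs, so let [N] of them be given.
    For [0 <= c < 1] the sets [B_n = {x | c * phi_N x <= f_n x}] increase to
    [X]: where [phi_N x > 0] one has [c * phi_N x < f x].  The pairs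
    [(c * a_k, A_k `&` B_n)], completed by [(0, ~` B_n)], form a simple function
    below [f_n] of the same class, and by continuity of [mu] from below its
    basic sum tends to [c] times that of [phi_N].  Now let [c] tend to [1]. *)

(** Indexing by [option I] treats finite and infinite families alike; each use then transports the
    result to ['I_N.+1] or [nat] along a bijection. *)
Definition refine {X I : Type} (A : I -> set X) (B : set X) (o : option I) :
  set X := if o is Some i then A i `&` B else ~` B.

(* Isolates what the proof uses of [is_partition] and [is_covering]. *)
Record refinable {d : measure_display} {X : measurableType d}
    (Q : forall I : Type, (I -> set X) -> Prop) : Prop := Refinable {
  refinable_measurable : forall (I : Type) (A : I -> set X),
    Q I A -> forall i, measurable (A i) ;
  refinable_refine : forall (I : Type) (A : I -> set X) (B : set X),
    measurable B -> Q I A -> Q (option I) (refine A B) ;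
  refinable_reindex : forall (I J : Type) (A : I -> set X) (h : J -> I),
    bijective h -> Q I A -> Q J (A \o h) }.

Lemma refinable_covering {d : measure_display} {X : measurableType d} :
  refinable (fun I => @is_covering d X I).
Proof.
split=> [I A [] //|I A B mB [mA UA]|I J A h [g _ gK] [mA UA]]; split.
- by case=> [i|]; [exact: measurableI|exact: measurableC].
- rewrite -subTset => x _; have [Bx|nBx] := pselect (B x); last by exists None.
  have /= [i _ Aix] : (\bigcup_i A i) x by rewrite UA.
  by exists (Some i).
- by move=> j; exact: mA.
- rewrite -subTset => x _; have /= [i _ Aix] : (\bigcup_i A i) x by rewrite UA.
  by exists (g i) => //=; rewrite gK.
Qed.

Lemma refinable_partition {d : measure_display} {X : measurableType d} :
  refinable (fun I => @is_partition d X I).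
Proof.
have rc := @refinable_covering d X.
split=> [I A [] //|I A B mB [mA tA UA]|I J A h bh [mA tA UA]].
- have [mR UR] := refinable_refine _ rc I A B mB (conj mA UA); split=> //.
  move=> [i|] [j|] _ _ //= [x [] /=].
  + by move=> [Ai _] [Aj _]; congr Some; apply: tA => //; exists x.
  + by move=> [_ Bx] nBx.
  + by move=> nBx [_ Bx].
- have [mh Uh] := refinable_reindex _ rc I J A h bh (conj mA UA); split=> //.
  move=> i j _ _ /= Aij; apply: (bij_inj bh); exact: tA.
Qed.

(** This is the passage [c] to 1. The instance [c = 0] rules out [M = -oo] and makes a finite [M]
    nonnegative. *)
Lemma le_of_scaled_le {R : realType} (t : R) (M : \bar R) : 0 <= t ->
  (forall c, 0 <= c < 1 -> ((c * t)%:E <= M)%E) -> (t%:E <= M)%E.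
Proof.
move=> t0; case: M => [r| |] h; last 2 first.
- by rewrite leey.
- by have := h 0; rewrite lexx ltr01 => /(_ isT); rewrite leNgt ltNyr.
have r0 : 0 <= r.
  by have := h 0; rewrite lexx ltr01 mul0r lee_fin => /(_ isT).
rewrite lee_fin leNgt; apply/negP => rt.
have tpos : 0 < t by exact: le_lt_trans rt.
have [rm mt] := midf_lt rt.
(* This [c] makes [c * t] the midpoint of [r] and [t], which exceeds [r]. *)
have c01 : 0 <= (r + t) / 2 / t < 1.
  by rewrite ltr_pdivrMr// mul1r mt andbT !divr_ge0// addr_ge0// ltW.
have := h _ c01.
by rewrite divfK ?gt_eqF// lee_fin leNgt rm.
Qed.

Section MonotoneConvergence.
Context {R : realType} {d : measure_display} {X : measurableType d}.
Context (mu : set X -> R) (hmu : monotone_measure mu).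
Context (f_ : nat -> X -> R) (f : X -> R).
Context (mf_ : forall n, measurable_fun [set: X] (f_ n)).
Context (f_ge0 : forall n x, 0 <= f_ n x).
Context (f_incr : forall x, nondecreasing_seq (fun n => f_ n x)).
Context (f_cvg : forall x, f_ n x @[n --> \oo] --> f x).

Lemma f_le_lim n x : f_ n x <= f x.
Proof.
rewrite -(cvg_lim _ (f_cvg x))//.
apply: nondecreasing_cvgn_le => //; apply/cvg_ex; exists (f x); exact: f_cvg.
Qed.

(** The analytic core, common to all four classes. The last hypothesis hides the class: it says that
    a scaled sum cut down to [B] and lying below some [f_ n] is already accounted for by [M]. *)
Lemma finite_sum_le (I : finType) (a : I -> R) (A : I -> set X) (M : \bar R) :
  (forall i, 0 <= a i) -> (forall i, measurable (A i)) ->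
  (forall x, \sum_i a i * \1_(A i) x <= f x) ->
  (forall n c B, 0 <= c -> measurable B ->
    (forall x, \sum_i c * a i * \1_(A i `&` B) x <= f_ n x) ->
    ((\sum_i c * a i * mu (A i `&` B))%:E <= M)%E) ->
  ((\sum_i a i * mu (A i))%:E <= M)%E.
Proof.
move=> a0 mA aAf hM; apply: le_of_scaled_le => [|c /andP[c0 c1]].
  by apply: sumr_ge0 => i _; rewrite mulr_ge0// (mm_ge0 hmu).
pose phi x : R := \sum_i a i * \1_(A i) x.
pose B n := [set x | c * phi x <= f_ n x].
have phi0 x : 0 <= phi x by apply: sumr_ge0 => i _; rewrite mulr_ge0.
have mB n : measurable (B n).
  rewrite -[B n]setTI; apply: measurable_fun_le => //.
  apply: measurable_funM => //; apply: measurable_sum => i.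
  by apply: measurable_funM => //; exact: measurable_indic.
have ndB : nondecreasing_seq B.
  move=> m n mn; rewrite subsetEset => x /= /le_trans; apply; exact: f_incr.
have UB : \bigcup_n B n = setT.
  rewrite -subTset => x _.
  (* Where [phi x = 0] the strict inequality [c * phi x < f x] may fail, but [f_ 0 x >= 0] puts [x]
     in [B 0]. *)
  have := phi0 x; rewrite le_eqVlt => /orP[/eqP p0|p0].
    by exists 0%N => //; rewrite /B/= -p0 mulr0.
  have clt : c * phi x < f x.
    by apply: lt_le_trans (aAf x); rewrite gtr_pMl.
  have [n _ Hn] := cvgr_ge _ (f_cvg x) _ clt.
  by exists n => //; exact: (Hn n (leqnn n)).
have cvgS : \sum_i c * a i * mu (A i `&` B n) @[n --> \oo] -->
    c * (\sum_i a i * mu (A i)).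
  rewrite mulr_sumr.
  apply: cvg_big => [|i _]; first exact: add_continuous.
  rewrite mulrA; apply: cvgMr.
  (* For each [i], the sets [A i] cut by [B n] increase to [A i], so continuity from below applies
     term by term. *)
  rewrite -{2}(setIT (A i)) -UB setI_bigcupr.
  apply: (mm_continuous_below hmu) => [n|m n mn]; first exact: measurableI.
  rewrite subsetEset; apply: setIS; rewrite -subsetEset; exact: ndB.
have cvgE : (\sum_i c * a i * mu (A i `&` B n))%:E @[n --> \oo] -->
    (c * (\sum_i a i * mu (A i)))%:E.
  by apply/fine_cvgP; split=> //; exact: nearW.
rewrite -(cvg_lim _ cvgE)//; apply: lime_le.
  by apply/cvg_ex; exists (c * (\sum_i a i * mu (A i)))%:E.
apply: nearW => n; apply: (hM n) => // x.
(* On [B n] the cut sum is at most [c * phi x]; off [B n] every indicator vanishes and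
   [f_ n x >= 0]. *)
have [Bx|nBx] := pselect (B n x).
  apply: le_trans Bx; rewrite /phi mulr_sumr; apply: ler_sum => i _.
  by rewrite indicI/= -mulrA !ler_wpM2l// ler_piMr//
    [\1_(B n) x]indicE lern1 leq_b1.
rewrite big1// => i _.
by rewrite indicI/= [\1_(B n) x]indicE memNset// !mulr0.
Qed.

Context (Q : forall I : Type, (I -> set X) -> Prop) (rQ : refinable Q).

Lemma int_below_fin_le (S : set (simple_seq R X)) (M : \bar R) :
  S = [set phi | exists (n : nat) (s : 'I_n -> R * set X),
    [/\ phi = FinSimple s, forall k, 0 <= (s k).1 &
        Q _ (fun k => (s k).2)]] ->
  (forall n, (int_below S mu (f_ n) <= M)%E) -> (int_below S mu f <= M)%E.
Proof.
move=> SE hM; apply: ge_ereal_sup => _ [phi [+ phif] <-].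
rewrite {1}SE => -[N [s [phiE s0 Qs]]]; rewrite {}phiE /= in phif *.
rewrite sumEFin; apply: finite_sum_le => //.
- exact: refinable_measurable Qs.
- by move=> x; rewrite -lee_fin -sumEFin.
move=> n c B c0 mB le_fn.
apply: le_trans (hM n); apply: ereal_sup_ubound => /=.
pose t (k : 'I_N.+1) : R * set X :=
  (oapp (fun j => c * (s j).1) 0 (unlift ord0 k),
   refine (fun j => (s j).2) B (unlift ord0 k)).
have unlift_bij : bijective (@unlift N.+1 ord0).
  exists (oapp (lift ord0) ord0) => [k|[j|]] /=; rewrite ?liftK ?unlift_none//.
  by case: unliftP.
(* Taking [g] to be [mu] gives the basic sum of [t]; taking evaluation of indicators at [x] gives
   its value there. *)
have sumt (g : set X -> R) : (\sum_(k < N.+1) ((t k).1 * g (t k).2)%:E)%E =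
    (\sum_(k < N) c * (s k).1 * g ((s k).2 `&` B))%:E.
  rewrite big_ord_recl /= unlift_none mul0r add0e sumEFin.
  by congr EFin; apply: eq_bigr => k _; rewrite (liftK ord0 k).
exists (FinSimple t); last exact: sumt.
split; last by move=> x; rewrite /= (sumt (fun A => \1_A x)) lee_fin.
rewrite SE; exists N.+1, t; split=> // [k|].
  by rewrite /t; case: unliftP => [j _|_] /=; rewrite ?mulr_ge0.
exact: (refinable_reindex _ rQ _ _ _ _ unlift_bij
  (refinable_refine _ rQ _ _ _ mB Qs)).
Qed.

Lemma int_below_inf_le (S : set (simple_seq R X)) (M : \bar R) :
  S = [set phi | exists s : nat -> R * set X,
    [/\ phi = InfSimple s, forall k, 0 <= (s k).1,
        (basic_sum mu phi < +oo)%E & Q _ (fun k => (s k).2)]] ->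
  (forall n, (int_below S mu (f_ n) <= M)%E) -> (int_below S mu f <= M)%E.
Proof.
move=> SE hM; apply: ge_ereal_sup => _ [phi [+ phif] <-].
rewrite {1}SE => -[s [phiE s0 _ Qs]]; rewrite {}phiE /= in phif *.
have ms k : measurable (s k).2 := refinable_measurable _ rQ _ _ Qs k.
apply: lime_le.
  by apply: is_cvg_nneseries => k _ _; rewrite lee_fin mulr_ge0// (mm_ge0 hmu).
apply: nearW => N; rewrite big_mkord sumEFin.
(* The first [N] terms have nonnegative remainder, so the truncated function still lies below
   [f]. *)
apply: (finite_sum_le _ (fun k : 'I_N => (s k).1) (fun k => (s k).2)) => //.
  move=> x; rewrite -lee_fin; apply: le_trans (phif x).
  rewrite -sumEFin -(big_mkord xpredT (fun k => ((s k).1 * \1_(s k).2 x)%:E)).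
  by apply: nneseries_lim_ge => k _ _; rewrite lee_fin mulr_ge0.
move=> n c B c0 mB le_fn.
apply: le_trans (hM n); apply: ereal_sup_ubound => /=.
pose pred_opt k := if k is j.+1 then Some j else None.
have pred_bij : bijective pred_opt.
  by exists (oapp succn 0%N) => [[]|[]].
(* The sets beyond the first [N] are kept with coefficient 0: the family remains in [Q], and the
   basic sum becomes finite. *)
pose t k : R * set X :=
  (oapp (fun j => if (j < N)%N then c * (s j).1 else 0) 0 (pred_opt k),
   refine (fun j => (s j).2) B (pred_opt k)).
have Qt : Q _ (fun k => (t k).2).
  exact: (refinable_reindex _ rQ _ _ _ _ pred_bij
    (refinable_refine _ rQ _ _ _ mB Qs)).
have t0 k : 0 <= (t k).1.
  by rewrite /t; case: k => [|k] //=; case: ifP => // _; rewrite mulr_ge0.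
have sumt (g : set X -> R) : (forall A, measurable A -> 0 <= g A) ->
    (\sum_(0 <= k <oo) ((t k).1 * g (t k).2)%:E)%E =
    (\sum_(k < N) c * (s k).1 * g ((s k).2 `&` B))%:E.
  (* The cut is at [N.+1] because index 0 holds the complement of [B], which shifts the original
     pairs by one. *)
  move=> g0; rewrite (nneseries_split 0%N N.+1); last first.
    move=> k _; rewrite lee_fin mulr_ge0// g0//.
    exact: (refinable_measurable _ rQ _ _ Qt).
  rewrite eseries0 ?adde0 => [|[|k]]//; last first.
    by rewrite add0n ltnS /= leqNgt => /negbTE -> _; rewrite mul0r.
  rewrite add0n big_mkord big_ord_recl/= mul0r add0e sumEFin.
  by congr EFin; apply: eq_bigr => k _; rewrite ltn_ord.
exists (InfSimple t); last by rewrite /= sumt// => A; exact: mm_ge0.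
split; last by move=> x; rewrite /= (sumt (fun A => \1_A x)) ?lee_fin.
rewrite SE; exists t; split=> //.
by rewrite /= sumt ?ltry// => A; exact: mm_ge0.
Qed.

End MonotoneConvergence.

Theorem theorem10 (R : realType) (d : measure_display) (X : measurableType d)
    (mu : set X -> R) (hmu : monotone_measure mu)
    (S : set (simple_seq R X))
    (hS : [\/ S = SPplus, S = SPplus_mu mu, S = SCplus | S = SCplus_mu mu])
    (f_ : nat -> X -> R) (f : X -> R)
    (mf_ : forall n, measurable_fun [set: X] (f_ n))
    (f_ge0 : forall n x, 0 <= f_ n x)
    (f_incr : forall x, nondecreasing_seq (fun n => f_ n x))
    (f_cvg : forall x, f_ n x @[n --> \oo] --> f x) :
  int_below S mu (f_ n) @[n --> \oo] --> int_below S mu f.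
Proof.
have int_mono g h : (forall x, g x <= h x) ->
    (int_below S mu g <= int_below S mu h)%E.
  move=> gh; apply: ereal_sup_le => _ [phi [Sphi phig] <-].
  exists phi => //; split=> // x; apply: le_trans (phig x) _.
  by rewrite lee_fin.
(* The integrals increase with [n], so their limit is their supremum, and only this identity has
   content. *)
have -> : int_below S mu f = ereal_sup (range (fun n => int_below S mu (f_ n))).
  apply/eqP; rewrite eq_le; apply/andP; split; last first.
    apply: ge_ereal_sup => _ [n _ <-]; apply: int_mono => x.
    exact: (f_le_lim _ _ f_incr f_cvg).
  have hM n : (int_below S mu (f_ n) <=
      ereal_sup (range (fun n => int_below S mu (f_ n))))%E.
    by apply: ereal_sup_ubound; exists n.
  have rP := @refinable_partition d X; have rC := @refinable_covering d X.
  case: hS => SE.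
  - exact: (int_below_fin_le mu hmu f_ f mf_ f_ge0 f_incr f_cvg _ rP).
  - exact: (int_below_inf_le mu hmu f_ f mf_ f_ge0 f_incr f_cvg _ rP).
  - exact: (int_below_fin_le mu hmu f_ f mf_ f_ge0 f_incr f_cvg _ rC).
  - exact: (int_below_inf_le mu hmu f_ f mf_ f_ge0 f_incr f_cvg _ rC).
apply: ereal_nondecreasing_cvgn => m n mn; apply: int_mono => x.
exact: f_incr.
Qed.
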